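(* Let $A$ be a finite non-empty alphabet and let $x\in A^\omega$ be an infinite word that is not uniformly recurrent. Then $x\in\mathcal P$.
   Context: $A^\omega$ is the set of one-sided infinite words over $A$; $\mathrm{Fact}^+x$ is the set of non-empty finite factors (contiguous blocks) of $x$. A factorization of $x$ is an expression $x=U_1U_2U_3\cdots$ with all $U_i$ non-empty finite words. $\mathcal P$ is the class of infinite words $x$ over finite alphabets for which there exist a finite set $C$ and a map (coloring) $c:\mathrm{Fact}^+x\to C$ such that for each factorization $x=U_1U_2U_3\cdots$ there exist $i,j\ge1$ with $c(U_i)\ne c(U_j)$. A factor $u$ of $x$ is uniformly recurrent in $x$ if there is an integer $k$ such that every factor of $x$ of length $k$ contains at least one occurrence of $u$; $x$ is uniformly recurrent if each of its factors is uniformly recurrent in $x$. *)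

(* Defs.v *)
From mathcomp Require Import all_boot.
From mathcomp Require Import boolp classical_sets.

Set Implicit Arguments.
Unset Strict Implicit.
Unset Printing Implicit Defensive.

Local Open Scope classical_set_scope.

(* One-sided infinite words, with positions and blocks numbered from 0. *)
Definition word (A : Type) := nat -> A.

Definition block (A : Type) (x : word A) (i n : nat) : seq A :=
  mkseq (fun k => x (i + k)) n.

Definition factors (A : Type) (x : word A) : set (seq A) :=
  [set u | exists i n, u = block x i n].

Definition nonempty_factors (A : Type) (x : word A) : set (seq A) :=
  [set u | factors x u /\ u <> [::]].

(* [x = U 0 U 1 U 2 ...]: since no [U i] is empty, the finite concatenations
   below have unbounded length, so they determine the infinite one. *)
Definition is_factorization (A : Type) (x : word A) (U : nat -> seq A) : Prop :=
  (forall i, U i <> [::]) /\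
  (forall n, let w := flatten (mkseq U n) in w = block x 0 (size w)).

Lemma is_factorization_nonempty_factors (A : Type) (x : word A)
    (U : nat -> seq A) (i : nat) :
  is_factorization x U -> nonempty_factors x (U i).
Proof.
move=> [U0 Ux]; split; last exact: U0.
set w := flatten (mkseq U i).
exists (size w), (size (U i)).
have := Ux i.+1; rewrite mkseqS -cats1 flatten_cat /= cats0 -/w size_cat.
rewrite /block /mkseq iotaD map_cat add0n -/w => /(congr1 (drop (size w))).
rewrite drop_size_cat // drop_size_cat ?size_map ?size_iota // => {1}->.
by rewrite -[X in iota X]addn0 iotaDl -map_comp.
Qed.

(* The blocks of a factorization of [x] are non-empty factors of [x] by
   [is_factorization_nonempty_factors], so [U] below ranges over all
   factorizations of [x]. *)
Definition class_P (A : finType) (x : word A) : Prop :=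
  exists (C : finType) (c : nonempty_factors x -> C),
    forall U : nat -> nonempty_factors x,
      is_factorization x (fun i => val (U i)) ->
      exists i j, c (U i) <> c (U j).

Definition factor_uniformly_recurrent (A : eqType) (x : word A) (u : seq A) :
    Prop :=
  exists k : nat, forall v, factors x v -> size v = k -> infix u v.

Definition uniformly_recurrent (A : eqType) (x : word A) : Prop :=
  forall u, factors x u -> factor_uniformly_recurrent x u.

(* Main.v *)
Require Import Defs.
From mathcomp Require Import all_boot.
From mathcomp Require Import boolp zify.

Set Implicit Arguments.
Unset Strict Implicit.
Unset Printing Implicit Defensive.

(** Let [p] be a prefix of [x] that does not occur in [x] with bounded gaps.
Colour a factor [v] by whether [v] and [v p] are prefixes of [x] and by
[min(|v|, |p|)].  In a monochromatic factorization [x = U_0 U_1 ...] the block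
[U_0] is a prefix of [x], hence so is every [U_j].  If the blocks are shorter
than [p] then [x] is periodic; otherwise [p] starts every block and every
[U_j p] is a prefix of [x].  In both cases [x] agrees with its prefix of length
[|U_j| + |p|] at the start of [U_j], so an occurrence-free gap of [p] inside
[U_j p] is already present earlier in [x]: no gap exceeds the one bounded by
[U_0], a contradiction. *)

Lemma blockD (A : Type) (x : word A) (i m n : nat) :
  block x i (m + n) = block x i m ++ block x (i + m) n.
Proof.
rewrite /block /mkseq iotaD map_cat add0n -[X in iota X n]addn0 iotaDl.
by rewrite -map_comp; congr (_ ++ _); apply: eq_map => k /=; rewrite addnA.
Qed.

Lemma size_block (A : Type) (x : word A) (i n : nat) : size (block x i n) = n.
Proof. exact: size_mkseq. Qed.

Lemma eq_blockP (A : Type) (x : word A) (i j n : nat) :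
  block x i n = block x j n <-> forall k, k < n -> x (i + k) = x (j + k).
Proof.
split=> [e k kn|e].
  by have := congr1 (fun s => nth (x 0) s k) e; rewrite !nth_mkseq.
apply: (@eq_from_nth _ (x 0)); rewrite !size_block // => k kn.
by rewrite !nth_mkseq // e.
Qed.

Lemma infix_block (A : eqType) (x : word A) (i n j m : nat) :
  j <= i -> i + n <= j + m -> infix (block x i n) (block x j m).
Proof.
move=> ji le_inm; apply/infixP.
exists (block x j (i - j)), (block x (i + n) (j + m - (i + n))).
rewrite -blockD -[in block x i _](subnKC ji) -blockD; congr block; lia.
Qed.

(** A factor of length [n] at position [i] sits inside the prefix of length [i + n], so bounded gaps
    for that prefix pass to the factor. *)
Lemma not_uniformly_recurrent_prefix (A : eqType) (x : word A) :
  ~ uniformly_recurrent x ->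
  exists n, ~ factor_uniformly_recurrent x (block x 0 n).
Proof.
move=> hx; apply: contrapT => H; apply: hx => u [i [n ->]].
have [k Hk] : factor_uniformly_recurrent x (block x 0 (i + n)).
  by apply: contrapT => H'; apply: H; exists (i + n).
exists k => v vx vk; apply: (infix_trans _ (Hk v vx vk)).
exact: infix_block.
Qed.

Definition cut (A : Type) (U : nat -> seq A) (j : nat) : nat :=
  size (flatten (mkseq U j)).

Lemma cutS (A : Type) (U : nat -> seq A) (j : nat) :
  cut U j.+1 = cut U j + size (U j).
Proof. by rewrite /cut mkseqS -cats1 flatten_cat size_cat /= cats0. Qed.

Lemma factorization_block (A : Type) (x : word A) (U : nat -> seq A) (j : nat) :
  is_factorization x U -> U j = block x (cut U j) (size (U j)).
Proof.
move=> [_ Ux]; have : flatten (mkseq U j.+1) = block x 0 (cut U j.+1) := Ux j.+1.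
rewrite cutS blockD mkseqS -cats1 flatten_cat /= cats0 => /(congr1 (drop (cut U j))).
by rewrite drop_size_cat // drop_size_cat ?size_block.
Qed.

Lemma increasing_bracket (s : nat -> nat) (i : nat) :
  s 0 = 0 -> (forall j, s j < s j.+1) -> exists j, s j <= i < s j.+1.
Proof.
move=> s0 sS; elim: i => [|i [j /andP[ji ij]]].
  by exists 0; have := sS 0; rewrite s0.
have [ij'|ij'] := ltnP i.+1 (s j.+1); first by exists j; rewrite ij' andbT ltnW.
by exists j.+1; rewrite ij' (leq_ltn_trans ij (sS j.+1)).
Qed.

Lemma prefix_occurs_near (A : Type) (x : word A) (s : nat -> nat) (n : nat) :
  s 0 = 0 -> (forall j, s j < s j.+1) ->
  (forall j m, m < s j.+1 - s j + n -> x (s j + m) = x m) ->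
  forall i, exists2 t, t <= s 1 & block x (i + t) n = block x 0 n.
Proof.
move=> s0 sS xs.
have occ j : block x (s j) n = block x 0 n.
  by apply/eq_blockP => k kn; rewrite add0n xs //; lia.
elim/ltn_ind => i IH.
have [[|j] /andP[ji ij]] := increasing_bracket i s0 sS.
  (* Inside the first block, the occurrence at [s 1] is close enough. *)
  by exists (s 1 - i); [lia | rewrite subnKC ?occ // ltnW].
have sj : 0 < s j.+1 by exact: leq_ltn_trans (sS j).
(* Shift back to the start of [x]. The occurrence found there is copied near [i] unless it would
   begin beyond [s j.+2], and then the one at [s j.+2] is nearer still. *)
have [|t ts tp] := IH (i - s j.+1); first by lia.
have [it|it] := leqP (i + t) (s j.+2); last first.
  by exists (s j.+2 - i); [lia | rewrite subnKC ?occ // ltnW].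
exists t => //; rewrite -tp; apply/eq_blockP => k kn.
rewrite -[RHS](xs j.+1); last by lia.
congr x; lia.
Qed.

Lemma prefix_uniformly_recurrent (A : eqType) (x : word A) (n b : nat) :
  (forall i, exists2 t, t <= b & block x (i + t) n = block x 0 n) ->
  factor_uniformly_recurrent x (block x 0 n).
Proof.
move=> H; exists (b + n) => v [i [m ->]]; rewrite size_block => ->.
have [t tb <-] := H i; apply: infix_block; lia.
Qed.

(** Capping the length at [n] keeps the colour set finite while still determining every length below
    [n]; [inord] loses nothing, since the minimum is at most [n]. *)
Definition prefix_color (A : eqType) (x : word A) (n : nat) (v : seq A) :
    bool * bool * 'I_n.+1 :=
  (v == block x 0 (size v),
   v ++ block x 0 n == block x 0 (size v + n),
   inord (minn (size v) n)).

Lemma monochromatic_prefix_agree (A : eqType) (x : word A) (n : nat)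
    (U : nat -> seq A) :
  is_factorization x U ->
  (forall i j, prefix_color x n (U i) = prefix_color x n (U j)) ->
  forall j m, m < size (U j) + n -> x (cut U j + m) = x m.
Proof.
move=> Ux mono.
have Ub j := factorization_block j Ux.
have U_prefix j : U j = block x 0 (size (U j)).
  (* The first colour component is true for [U 0], because [cut U 0] is 0. *)
  by apply/eqP; case: (mono j 0) => -> _ _; rewrite {1}(Ub 0).
have start j k : k < size (U j) -> x (cut U j + k) = x k.
  by move: k; apply/(eq_blockP x _ 0); rewrite -Ub.
have size_min j : minn (size (U j)) n = minn (size (U 0)) n.
  by case: (mono j 0) => _ _ /(congr1 val); rewrite /= !inordK // ltnS geq_minr.
have [short|long] := ltnP (size (U 0)) n; last first.
  have len j : n <= size (U j) by have := size_min j; lia.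
  have occ j k : k < n -> x (cut U j + k) = x k.
    by move=> kn; apply: start; exact: leq_trans (len j).
  have Up j : U j ++ block x 0 n = block x 0 (size (U j) + n).
    (* By monochromaticity [j = 0] suffices, and there [U 1], which follows [U 0] in [x], begins
       with the prefix of length [n]. *)
    apply/eqP; case: (mono j 0) => _ -> _.
    rewrite blockD -U_prefix; apply/eqP; congr (_ ++ _); apply/esym/eq_blockP.
    by move=> k kn; have := occ 1 k kn; rewrite cutS.
  move=> j m mn; have [mj|jm] := ltnP m (size (U j)); first exact: start.
  (* Beyond [U j] one reads the first [n] letters of [U j.+1]; [Up j] finds the same letters in [x]
     from position [size (U j)] on. *)
  rewrite -(subnKC jm) addnA -cutS occ; last by lia.
  have := Up j; rewrite blockD -U_prefix => /eqP.
  rewrite eqseq_cat // eqxx => /eqP/eq_blockP/(_ (m - size (U j))) -> //; lia.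
(* Below the cap the colour gives the exact length, so all blocks are the same prefix of length [d]
   and [x] has period [d]. *)
set d := size (U 0) in short size_min *.
have sizeU j : size (U j) = d by have := size_min j; lia.
have d_gt0 : 0 < d by rewrite /d; case: (U 0) (Ux.1 0).
have cutE j : cut U j = j * d by elim: j => // j IH; rewrite cutS IH sizeU mulSnr.
have per m : x m = x (m %% d).
  by rewrite {1}(divn_eq m d) -cutE start // sizeU ltn_mod.
by move=> j m _; rewrite per cutE modnMDl -per.
Qed.

Theorem theorem5p3 (A : finType) (hA : 0 < #|A|) (x : word A)
    (hx : ~ uniformly_recurrent x) :
  class_P x.
Proof.
have [n Hn] := not_uniformly_recurrent_prefix hx.
exists (bool * bool * 'I_n.+1)%type, (fun v => prefix_color x n (val v)).
move=> U Ux; apply: contrapT => H; apply: Hn.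
set V := fun i => val (U i) in Ux.
have mono i j : prefix_color x n (V i) = prefix_color x n (V j).
  by apply: contrapT => ne; apply: H; exists i, j.
apply: (prefix_uniformly_recurrent (b := cut V 1)).
apply: prefix_occurs_near => // [j|j m].
  by rewrite cutS -[X in X < _]addn0 ltn_add2l; case: (V j) (Ux.1 j).
by rewrite cutS addKn; exact: monochromatic_prefix_agree.
Qed.
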